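(* For each $n\ge 3$ there is a tight irreducible subcube partition of $\{0,1\}^n$ of size $2n-1$.
   Context: Subcubes of $\{0,1\}^n$ are sets fixing some coordinates to given bits, identified with words in $\{0,1,*\}^n$. A subcube partition of length $n$ is a partition of $\{0,1\}^n$ into subcubes; its size is the number of subcubes. It is irreducible if there is no subset $G$ with $1<|G|<|F|$ whose union is a subcube. It is tight if for every coordinate $i\in[n]$ some subcube $s$ in it has $s_i\ne *$. *)

(* Defs.v *)
From mathcomp Require Import all_boot.

Set Implicit Arguments.
Unset Strict Implicit.
Unset Printing Implicit Defensive.

Definition point (n : nat) := {ffun 'I_n -> bool}.

(* Words in {0,1,*}^n, with [None] standing for the star. *)
Definition word (n : nat) := {ffun 'I_n -> option bool}.

Definition subcube (n : nat) (s : word n) : {set point n} :=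
  [set x : point n | [forall i, (s i == None) || (s i == Some (x i))]].

(* This justifies identifying a subcube with its word; in particular a set of
   words has the same cardinality as the corresponding set of subcubes. *)
Lemma subcube_inj (n : nat) : injective (@subcube n).
Proof.
have sub_star (s t : word n) i : subcube s = subcube t ->
    s i = None -> t i = None.
  move=> st si; case ti: (t i) => [b|//].
  pose x : point n :=
    [ffun j => if j == i then ~~ b else if s j is Some c then c else false].
  have : x \in subcube s.
    rewrite inE; apply/forallP=> j; rewrite ffunE.
    by case: (j =P i) => [->|_]; [rewrite si | case: (s j) => //= c; rewrite eqxx].
  rewrite st inE => /forallP/(_ i); rewrite ti ffunE eqxx /=.
  by case: b {ti x}.
move=> s t st; apply/ffunP=> i.
case si: (s i) => [b|]; last by rewrite (sub_star s t).
case ti: (t i) => [c|]; last by rewrite (sub_star t s i) in si.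
pose x : point n := [ffun j => if s j is Some d then d else false].
have xs : x \in subcube s.
  rewrite inE; apply/forallP=> j; rewrite ffunE.
  by case: (s j) => //= d; rewrite eqxx.
move: (xs); rewrite st !inE => /forallP/(_ i); rewrite ti ffunE si /=.
by move/eqP=> [->].
Qed.

Definition subcube_partition (n : nat) (F : {set word n}) : bool :=
  partition [set subcube s | s in F] [set: point n].

Definition irreducible (n : nat) (F : {set word n}) : Prop :=
  ~ exists G : {set word n},
      [/\ G \subset F, 1 < #|G| < #|F|
        & exists s : word n, \bigcup_(t in G) subcube t = subcube s].

Definition tight (n : nat) (F : {set word n}) : Prop :=
  forall i : 'I_n, exists2 s : word n, s \in F & s i != None.

(* Main.v *)
Require Import Defs.
From mathcomp Require Import all_boot.
From mathcomp Require Import zify.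

(* Suppose a partition P of {0,1}^n contains, up to flips, two words that on
   some coordinates i, j read 00 and 1* and agree elsewhere, so that their union
   is L-shaped. The same L is also cut by *0 and 11. Put P on the face where a
   new coordinate is 0, put P with the L recut on the opposite face, and merge
   the words common to both faces: the size grows by 2, and the words 1* (new
   coordinate 0) and 11 (new coordinate 1) again form an L, so this can be
   iterated. A subcube that is a proper union of the new words cannot lie in one
   face, since an L is not a subcube; so it is a product with the new coordinate
   free, and since *0 meets both 00 and 1*, it contains both or neither of these.
   Hence irreducibility follows as soon as every proper subfamily of P whose
   union is a subcube contains exactly one of 00 and 1*. This holds in the base
   case {00, 01, 1*}, which is itself reducible, and in every irreducible P. *)

Set Implicit Arguments.
Unset Strict Implicit.
Unset Printing Implicit Defensive.

(** * Pointwise criteria for subcubes and partitions *)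

Definition compat (o : option bool) (b : bool) := (o == None) || (o == Some b).

Lemma subcubeP n (s : word n) (x : point n) :
  reflect (forall i, compat (s i) (x i)) (x \in subcube s).
Proof. by rewrite inE; apply: forallP. Qed.

Lemma subcube_neq0 n (s : word n) : exists x : point n, x \in subcube s.
Proof.
exists [ffun i => odflt false (s i)]; apply/subcubeP => i.
by rewrite ffunE /compat; case: (s i) => [[]|].
Qed.

(** A subcube is a product of sets of bits, one for each coordinate, so coordinates of two of its
    points may be mixed freely. *)
Lemma subcube_mix n (s : word n) (x y z : point n) :
  x \in subcube s -> y \in subcube s ->
  (forall k, z k = x k \/ z k = y k) -> z \in subcube s.
Proof.
move=> /subcubeP xs /subcubeP ys h; apply/subcubeP => k.
by case: (h k) => ->.
Qed.

Lemma partitionP n (F : {set word n}) :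
  reflect ((forall x : point n, exists2 s, s \in F & x \in subcube s) /\
           (forall (x : point n) s t, s \in F -> t \in F ->
              x \in subcube s -> x \in subcube t -> s = t))
          (subcube_partition F).
Proof.
apply: (iffP and3P) => [[/eqP cov /trivIsetP triv _]|[cov uni]].
  split=> [x|x s t sF tF xs xt].
    have: x \in cover [set subcube s | s in F] by rewrite cov inE.
    by case/bigcupP=> _ /imsetP[s sF ->] xs; exists s.
  apply/eqP; apply: contraTT isT => st.
  have /triv := imset_f (@subcube n) sF => /(_ _ (imset_f (@subcube n) tF)).
  rewrite (inj_eq (@subcube_inj n)) => /(_ st) /pred0P /(_ x) /=.
  by rewrite xs xt.
split.
- apply/eqP/setP => x; rewrite inE; apply/bigcupP.
  by have [s sF xs] := cov x; exists (subcube s) => //; apply: imset_f.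
- apply/trivIsetP => _ _ /imsetP[s sF ->] /imsetP[t tF ->] st.
  apply/pred0P => x /=; apply/negP => /andP[xs xt].
  by rewrite (uni x s t) ?eqxx in st.
- apply/imsetP => -[s _ e]; have [x] := subcube_neq0 s.
  by rewrite -e inE.
Qed.

(** Blocks of a partition do not overlap, so a single point [x] of [s] decides whether [s] belongs
    to a subfamily with a given union. *)
Lemma partition_mem n (F G : {set word n}) r (x : point n) s :
  subcube_partition F -> G \subset F ->
  \bigcup_(t in G) subcube t = subcube r ->
  s \in F -> x \in subcube s -> (s \in G) = (x \in subcube r).
Proof.
move=> /partitionP[_ uni] /subsetP GF <- sF xs.
apply/idP/bigcupP => [sG|[t tG xt]]; first by exists s.
by rewrite (uni x s t) // GF.
Qed.

(** * Adding a new coordinate 0 and gluing two partitions along it *)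

(** Generic in [T] so as to serve both points and words. *)
Definition fcons T n (a : T) (f : {ffun 'I_n -> T}) : {ffun 'I_n.+1 -> T} :=
  [ffun k => if unlift ord0 k is Some j then f j else a].

Lemma fcons0 T n (a : T) (f : {ffun 'I_n -> T}) : fcons a f ord0 = a.
Proof. by rewrite ffunE unlift_none. Qed.

Lemma fconsS T n (a : T) (f : {ffun 'I_n -> T}) i :
  fcons a f (lift ord0 i) = f i.
Proof. by rewrite ffunE liftK. Qed.

Lemma fconsP T n (g : {ffun 'I_n.+1 -> T}) : exists a f, g = fcons a f.
Proof.
exists (g ord0), [ffun i => g (lift ord0 i)]; apply/ffunP => k.
by case: (unliftP ord0 k) => [j|] ->; rewrite ?fcons0 // fconsS ffunE.
Qed.

Lemma fcons_inj T n (a b : T) (f g : {ffun 'I_n -> T}) :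
  fcons a f = fcons b g -> a = b /\ f = g.
Proof.
move=> e; split; first by rewrite -(fcons0 a f) e fcons0.
by apply/ffunP => i; rewrite -(fconsS a f) e fconsS.
Qed.

Lemma mem_fcons n o (s : word n) b (x : point n) :
  (fcons b x \in subcube (fcons o s)) = compat o b && (x \in subcube s).
Proof.
apply/subcubeP/andP => [h|[ob /subcubeP h] k].
  split; first by have := h ord0; rewrite !fcons0.
  by apply/subcubeP => i; have := h (lift ord0 i); rewrite !fconsS.
by case: (unliftP ord0 k) => [j|] ->; rewrite ?fcons0 ?fconsS.
Qed.

Lemma fcons_imset n o o' (A : {set word n}) s :
  (fcons o s \in fcons o' @: A) = (o == o') && (s \in A).
Proof.
apply/imsetP/andP => [[t tA e]|[/eqP-> sA]]; last by exists s.
by have [-> ->] := fcons_inj e.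
Qed.

(* The partition of length [n.+1] whose slices along coordinate [0] are [P]
   and [P :\: D :|: E]. *)
Definition glue n (P D E : {set word n}) : {set word n.+1} :=
  [set fcons None u | u in P :\: D] :|: [set fcons (Some false) u | u in D]
  :|: [set fcons (Some true) u | u in E].

Lemma mem_glue n (P D E : {set word n}) o u :
  (fcons o u \in glue P D E) =
  match o with
  | None => (u \notin D) && (u \in P)
  | Some false => u \in D
  | Some true => u \in E
  end.
Proof.
rewrite !in_setU !fcons_imset in_setD.
by case: o => [[]|]; rewrite /= ?orbF.
Qed.

(** Words of [P] outside [D] are shared by both faces and counted once; [D] and [E] contribute one
    word each per element. *)
Lemma card_glue n (P D E : {set word n}) : D \subset P ->
  #|glue P D E| = #|P| + #|E|.
Proof.
have card o (A : {set word n}) : #|[set fcons o u | u in A]| = #|A|.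
  by apply: card_imset => u v e; have [] := fcons_inj e.
have disj (o o' : option bool) (A B : {set word n}) : o != o' ->
    [set fcons o u | u in A] :&: [set fcons o' u | u in B] = set0.
  move=> oo'; apply/setP => w; rewrite inE in_set0; apply/negP => /andP[].
  case/imsetP=> u _ -> /imsetP[v _ e].
  by have [e' _] := fcons_inj e; rewrite e' eqxx in oo'.
move=> DP; rewrite cardsU setIUl !disj // setU0 cards0 subn0.
rewrite cardsU disj // cards0 subn0 !card cardsD (setIidPr DP).
by rewrite subnK // subset_leq_card.
Qed.

Definition slice n (P D E : {set word n}) b := if b then P :\: D :|: E else P.

Lemma mem_slice n (P D E : {set word n}) o u b : D \subset P ->
  fcons o u \in glue P D E -> compat o b -> u \in slice P D E b.
Proof.
move=> /subsetP DP; rewrite mem_glue /slice.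
case: o b => [[]|] [] //= uP _; rewrite ?in_setU ?in_setD ?uP ?orbT //.
- by apply: DP.
- by case/andP: uP.
Qed.

Lemma slice_mem n (P D E : {set word n}) u b : u \in slice P D E b ->
  exists2 o, compat o b & fcons o u \in glue P D E.
Proof.
rewrite /slice; case: b.
  rewrite in_setU in_setD => /orP[uP|uE]; first by exists None; rewrite ?mem_glue.
  by exists (Some true); rewrite ?mem_glue.
move=> uP; have [uD|uD] := boolP (u \in D).
  by exists (Some false); rewrite ?mem_glue.
by exists None; rewrite ?mem_glue ?uD.
Qed.

(** A point with new coordinate [b] meets only words coming from [slice P D E b], which is a
    partition. Disjointness of [E] and [P] keeps a word from occurring both with a star and with
    [Some true] in front. *)
Lemma glue_partition n (P D E : {set word n}) :
  D \subset P -> [disjoint E & P] ->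
  subcube_partition P -> subcube_partition (P :\: D :|: E) ->
  subcube_partition (glue P D E).
Proof.
move=> DP EP pP pQ.
have pS b : subcube_partition (slice P D E b) by case: b.
apply/partitionP; split=> [x|x s t].
  have [b [y ->]] := fconsP x.
  have /partitionP[cov _] := pS b; have [u /slice_mem[o ob og] yu] := cov y.
  by exists (fcons o u) => //; rewrite mem_fcons ob.
have [b [y ->]] := fconsP x; have [o [u ->]] := fconsP s.
have [o' [v ->]] := fconsP t => ug vg; rewrite !mem_fcons.
move=> /andP[ob yu] /andP[ob' yv].
have /partitionP[_ uni] := pS b.
have uv : u = v by apply: (uni y) => //; apply: mem_slice; eassumption.
rewrite -uv {v uv yv} in vg *; congr fcons; move: ug vg; rewrite !mem_glue.
have: (u \in D) ==> (u \in P) by apply/implyP/subsetP.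
have: (u \in E) ==> (u \notin P) by apply/implyP => /(disjointFr EP) ->.
case: (u \in D); case: (u \in E); case: (u \in P) => // _ _;
  by move: ob ob'; case: (b); case: o => [[]|]; case: o' => [[]|].
Qed.

Lemma glue_tight n (P D E : {set word n}) w :
  D \subset P -> tight P -> w \in D -> tight (glue P D E).
Proof.
move=> DP tP wD k; case: (unliftP ord0 k) => [i|] ->.
  have [u uP ui] := tP i.
  have [o _ ug] := @slice_mem _ P D E u false uP.
  by exists (fcons o u); rewrite ?fconsS.
by exists (fcons (Some false) w); rewrite ?mem_glue ?fcons0.
Qed.

(** * L-shapes and their two cuts *)

Definition upd2 n (w : word n) i j p q : word n :=
  [ffun k => if k == i then p else if k == j then q else w k].

Definition plane n (w : word n) i j := upd2 w i j None None.

(* [corner] and [arm] cut an L-shape (a square minus one quarter) out of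
   [plane]; exchanging [(i, a)] with [(j, ~~ b)] cuts the same L-shape the
   other way. *)
Definition corner n (w : word n) i j a b := upd2 w i j (Some a) (Some b).
Definition arm n (w : word n) i j a := upd2 w i j (Some (~~ a)) None.
Definition elbow n (w : word n) i j a b : {set word n} :=
  [set corner w i j a b; arm w i j a].

Lemma mem_upd2 n (w : word n) i j p q (x : point n) : i != j ->
  (x \in subcube (upd2 w i j p q)) =
  [&& compat p (x i), compat q (x j) & x \in subcube (plane w i j)].
Proof.
move=> ij; have ji : j == i = false by rewrite eq_sym (negbTE ij).
apply/subcubeP/and3P => [h|[pi qj /subcubeP h] k].
  split; [have := h i | have := h j | apply/subcubeP => k; have := h k];
    rewrite !ffunE ?eqxx ?ji //.
  by case: eqP => // _; case: eqP.
have := h k; rewrite !ffunE.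
by case: eqP => [->|_] //; case: eqP => [->|].
Qed.

Lemma plane_sym n (w : word n) i j : plane w i j = plane w j i.
Proof. by apply/ffunP => k; rewrite !ffunE; do 2 case: eqP. Qed.

Lemma mem_corner n (w : word n) i j a b (x : point n) : i != j ->
  (x \in subcube (corner w i j a b)) =
  [&& x i == a, x j == b & x \in subcube (plane w i j)].
Proof.
by move=> ij; rewrite mem_upd2 //; case: a b (x i) (x j) => [] [] [] [].
Qed.

Lemma mem_arm n (w : word n) i j a (x : point n) : i != j ->
  (x \in subcube (arm w i j a)) = (x i != a) && (x \in subcube (plane w i j)).
Proof.
by move=> ij; rewrite mem_upd2 //; case: a (x i) => [] [].
Qed.

Lemma plane_point n (w : word n) i j a b : i != j ->
  exists x : point n, [/\ x i = a, x j = b & x \in subcube (plane w i j)].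
Proof.
move=> ij; have [x] := subcube_neq0 (corner w i j a b).
by rewrite mem_corner // => /and3P[/eqP xi /eqP xj xp]; exists x.
Qed.

Lemma corner_neq_arm n (w : word n) i j a b : corner w i j a b != arm w i j a.
Proof. by apply/eqP => /ffunP/(_ i); rewrite !ffunE eqxx => -[]; case: a. Qed.

Lemma card_elbow n (w : word n) i j a b : #|elbow w i j a b| = 2.
Proof. by rewrite cards2 corner_neq_arm. Qed.

(** From a point [x] of the corner and a point [y] of the arm, mixing produces [z] in the missing
    quarter, where coordinate [i] is [a] and coordinate [j] is [~~ b]. *)
Lemma elbow_not_subcube n (w : word n) i j a b r : i != j ->
  \bigcup_(u in elbow w i j a b) subcube u <> subcube r.
Proof.
move=> ij e; have mem x : (x \in subcube r) =
    (x \in subcube (corner w i j a b)) || (x \in subcube (arm w i j a)).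
  by rewrite -e bigcup_setU !big_set1 inE.
have [x [xi xj xp]] := plane_point w a b ij.
pose y : point n :=
    [ffun k => if k == i then ~~ a else if k == j then ~~ b else x k].
pose z : point n := [ffun k => if k == j then ~~ b else x k].
have ji : j == i = false by rewrite eq_sym (negbTE ij).
have yp : y \in subcube (plane w i j).
  move/subcubeP: xp => xp; apply/subcubeP => k; have := xp k.
  by rewrite !ffunE; case: eqP => //; case: eqP.
have xr : x \in subcube r by rewrite mem mem_corner // xi xj !eqxx xp.
have yr : y \in subcube r.
  by rewrite mem mem_arm // yp ffunE eqxx; case: (a); rewrite orbT.
have : z \in subcube r.
  apply: (subcube_mix xr yr) => k; rewrite !ffunE.
  have [->|kj] := eqVneq k j; first by right; rewrite ji.
  by left.
rewrite mem mem_corner // mem_arm // !ffunE eqxx (negbTE ij) xi eqxx.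
by case: (b).
Qed.

Lemma elbow_sub n (w : word n) i j a b r (G : {set word n}) : i != j ->
  G \subset elbow w i j a b -> 1 < #|G| ->
  \bigcup_(u in G) subcube u <> subcube r.
Proof.
move=> ij GD G1; have -> : G = elbow w i j a b.
  by apply/eqP; rewrite eqEcard GD card_elbow.
exact: elbow_not_subcube.
Qed.

(** Both sides describe [plane w i j] without the quarter where coordinate [i] is [a] and coordinate
    [j] is [~~ b]. *)
Lemma elbow_switch n (w : word n) i j a b (x : point n) : i != j ->
  (x \in subcube (corner w i j a b)) || (x \in subcube (arm w i j a)) =
  (x \in subcube (corner w j i (~~ b) (~~ a)))
  || (x \in subcube (arm w j i (~~ b))).
Proof.
move=> ij; have ji : j != i by rewrite eq_sym.
rewrite !mem_corner // !mem_arm // (plane_sym w j i).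
by case: (x i) (x j) a b (x \in _) => [] [] [] [] [].
Qed.

(** The new corner meets the old arm and the new arm meets the old corner. A new word in [P] would
    thus equal the old word it meets, but one has a star where the other has a bit. *)
Lemma elbow_disjoint n (P : {set word n}) w i j a b : i != j ->
  subcube_partition P -> elbow w i j a b \subset P ->
  [disjoint elbow w j i (~~ b) (~~ a) & P].
Proof.
move=> ij /partitionP[_ uni]; rewrite subUset !sub1set => /andP[cP aP].
have ji : j != i by rewrite eq_sym.
have [x [xi xj xp]] := plane_point w a b ij.
have [y [yi yj yp]] := plane_point w (~~ a) (~~ b) ij.
rewrite disjoints_subset subUset !sub1set !inE; apply/andP; split; apply/negP => uP.
  have/ffunP/(_ j) : arm w i j a = corner w j i (~~ b) (~~ a).
    apply: (uni y) => //; rewrite ?mem_arm ?mem_corner // ?(plane_sym w j i) yp.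
      by rewrite yi; case: (a).
    by rewrite yi yj !eqxx.
  by rewrite !ffunE !eqxx (negbTE ji).
have/ffunP/(_ i) : corner w i j a b = arm w j i (~~ b).
  apply: (uni x) => //; rewrite ?mem_arm ?mem_corner // ?(plane_sym w j i) xp.
    by rewrite xi xj !eqxx.
  by rewrite xj; case: (b).
by rewrite !ffunE !eqxx (negbTE ij).
Qed.

Lemma elbow_uniq n (w : word n) i j a b (x : point n) u v : i != j ->
  u \in elbow w i j a b -> v \in elbow w i j a b ->
  x \in subcube u -> x \in subcube v -> u = v.
Proof.
move=> ij; rewrite !in_set2 => /orP[] /eqP-> /orP[] /eqP-> //;
by rewrite mem_corner // mem_arm //; case: (x i == a).
Qed.

(** The old and new cuts cover the same region, so a word of [P] meeting a new word must belong to
    the old cut. *)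
Lemma elbow_flip_partition n (P : {set word n}) w i j a b : i != j ->
  subcube_partition P -> elbow w i j a b \subset P ->
  subcube_partition (P :\: elbow w i j a b :|: elbow w j i (~~ b) (~~ a)).
Proof.
move=> ij pP DP; have /partitionP[cov uni] := pP.
have mem w' i' j' a' b' (x : point n) :
    reflect (exists2 u, u \in elbow w' i' j' a' b' & x \in subcube u)
            ((x \in subcube (corner w' i' j' a' b'))
             || (x \in subcube (arm w' i' j' a'))).
  apply: (iffP orP) => [[] xu|[u]]; first by eexists; [apply: set21|].
    by eexists; [apply: set22|].
  by rewrite in_set2 => /orP[] /eqP-> xu; [left | right].
have excl (x : point n) u v : u \in P :\: elbow w i j a b ->
    v \in elbow w j i (~~ b) (~~ a) ->
    x \in subcube u -> x \in subcube v -> False.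
  rewrite in_setD => /andP[uD uP] vE xu xv.
  have : exists2 v, v \in elbow w j i (~~ b) (~~ a) & x \in subcube v by exists v.
  move/mem; rewrite -elbow_switch // => /mem[t tD xt].
  by rewrite (uni x u t) ?tD // (subsetP DP) in uD.
apply/partitionP; split=> [x|x u v].
  have [u uP xu] := cov x; have [uD|uD] := boolP (u \in elbow w i j a b).
    have : exists2 u, u \in elbow w i j a b & x \in subcube u by exists u.
    move/mem; rewrite elbow_switch // => /mem[v vE xv].
    by exists v => //; rewrite in_setU vE orbT.
  by exists u => //; rewrite in_setU in_setD uD uP.
rewrite !(in_setU _ (_ :\: _)) => /orP[] uQ /orP[] vQ xu xv.
- by move: uQ vQ; rewrite !in_setD => /andP[_ uP] /andP[_ vP]; apply: (uni x).
- by case: (excl x u v).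
- by case: (excl x v u).
- by apply: (elbow_uniq _ uQ vQ xu xv); rewrite eq_sym.
Qed.

(** * Irreducibility of the glued partition *)

Definition splits_elbow n (P : {set word n}) w i j a b :=
  forall (G : {set word n}) r, G \subset P -> 1 < #|G| < #|P| ->
  \bigcup_(u in G) subcube u = subcube r ->
  (corner w i j a b \in G) != (arm w i j a \in G).

Lemma irreducible_splits n (P : {set word n}) w i j a b :
  irreducible P -> splits_elbow P w i j a b.
Proof. by move=> irr G r GP cG e; case: irr; exists G; split=> //; exists r. Qed.

Lemma subcube_sub_partition n (P : {set word n}) u v : subcube_partition P ->
  u \in P -> v \in P -> subcube u \subset subcube v -> u = v.
Proof.
move=> /partitionP[_ uni] uP vP /subsetP uv; have [x xu] := subcube_neq0 u.
exact: (uni x) (uv x xu).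
Qed.

Lemma glue_irreducible n (P : {set word n}) w i j a b : i != j ->
  subcube_partition P -> elbow w i j a b \subset P ->
  splits_elbow P w i j a b ->
  irreducible (glue P (elbow w i j a b) (elbow w j i (~~ b) (~~ a))).
Proof.
set D := elbow w i j a b; set E := elbow w j i _ _ => ij pP DP spl.
have ji : j != i by rewrite eq_sym.
have pQ := elbow_flip_partition ij pP DP; have EP := elbow_disjoint ij pP DP.
have pF := glue_partition DP EP pP pQ; rewrite -/D -/E in pQ EP pF.
have /andP[cP aP] : (corner w i j a b \in P) && (arm w i j a \in P).
  by move: DP; rewrite subUset !sub1set.
case=> G [GF /andP[G1 GF1] [r0 e]]; have [o [r er]] := fconsP r0.
rewrite {r0}er in e.
(* [S b] is the trace of [G] on the face where the new coordinate is [b]. *)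
pose S b := [set u in slice P D E b |
  (fcons None u \in G) || (fcons (Some b) u \in G)].
have SE c u : (u \in S c) = [exists o, compat o c && (fcons o u \in G)].
  rewrite inE; apply/andP/existsP => [[_ /orP[uG|uG]]|[p /andP[pc pG]]].
  - by exists None.
  - by exists (Some c); rewrite /compat eqxx.
  split; first exact: (mem_slice DP (subsetP GF _ pG)).
  by case/orP: pc pG => /eqP-> ->; rewrite ?orbT.
have headE u p : fcons p u \in G -> forall c, compat p c -> compat o c.
  move=> uG c pc; have [x xu] := subcube_neq0 u.
  have : fcons c x \in subcube (fcons o r).
    by rewrite -e; apply/bigcupP; exists (fcons p u); rewrite ?mem_fcons ?pc.
  by rewrite mem_fcons => /andP[].
have unionS c : compat o c -> \bigcup_(u in S c) subcube u = subcube r.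
  move=> oc; apply/setP => x.
  have: (fcons c x \in subcube (fcons o r)) = (x \in subcube r).
    by rewrite mem_fcons oc.
  rewrite -e => <-; apply/bigcupP/bigcupP => [[u]|[s sG]].
    rewrite SE => /existsP[p /andP[pc pG]] xu.
    by exists (fcons p u); rewrite ?mem_fcons ?pc.
  have [p [u es]] := fconsP s; subst s; rewrite mem_fcons => /andP[pc xu].
  by exists u => //; rewrite SE; apply/existsP; exists p; rewrite pc.
have SG c : S c \subset slice P D E c by apply/subsetP => u; rewrite inE => /andP[].
have pS c : subcube_partition (slice P D E c) by case: c.
(* If the new coordinate is fixed to [c], every word of [G] starts with [Some c]. Then [S c] has at
   least two words, all from one cut of the L, and their union cannot be a subcube. *)
case: o headE unionS e => [c|] headE unionS e.
  have cE p u : fcons p u \in G -> p = Some c.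
    move=> /headE; case: p => [d|] h; last by have := h (~~ c) isT; case: (c).
    by have := h d; rewrite /compat eqxx orbT => /(_ isT) /eqP ->.
  have SD : S c \subset if c then E else D.
    apply/subsetP => u; rewrite SE => /existsP[p /andP[_ pG]].
    have := subsetP GF _ pG; rewrite (cE _ _ pG) mem_glue.
    by case: (c).
  have GS : G \subset [set fcons (Some c) u | u in S c].
    apply/subsetP => s sG; have [p [u es]] := fconsP s; subst s.
    have ep := cE _ _ sG; subst p; rewrite fcons_imset eqxx SE.
    by apply/existsP; exists (Some c); rewrite sG /compat eqxx orbT.
  have S1 : 1 < #|S c|.
    by apply: leq_trans G1 (leq_trans (subset_leq_card GS) (leq_imset_card _ _)).
  have := unionS c; rewrite /compat eqxx orbT => /(_ isT).
  by case: (c) SD S1 => SD S1; apply: elbow_sub SD S1.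
have memS c u x : u \in slice P D E c -> x \in subcube u ->
    (u \in S c) = (x \in subcube r).
  by move=> uS xu; apply: (partition_mem (pS c) (SG c)) => //; apply: unionS.
(* The flipped arm meets both the corner and the arm, so [r] cannot separate
   them. *)
have same : (corner w i j a b \in S false) = (arm w i j a \in S false).
  have [x [xi xj xp]] := plane_point w a b ij.
  have [y [yi yj yp]] := plane_point w (~~ a) b ij.
  have aQ : arm w j i (~~ b) \in slice P D E true by rewrite /= in_setU set22 orbT.
  have xc : x \in subcube (corner w i j a b).
    by rewrite mem_corner // xi xj !eqxx xp.
  have ya : y \in subcube (arm w i j a) by rewrite mem_arm // yi yp; case: (a).
  have xa : x \in subcube (arm w j i (~~ b)).
    by rewrite mem_arm // plane_sym xj xp; case: (b).
  have yQ : y \in subcube (arm w j i (~~ b)).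
    by rewrite mem_arm // plane_sym yj yp; case: (b).
  rewrite (memS false _ x) // (memS false _ y) //.
  by rewrite -(memS true _ x aQ) // (memS true _ y aQ).
(* If the trace is a single word [u], then [same] puts [u] outside [D], so [u] lies in both slices.
   Every word of [G] then projects into [u], hence is [fcons None u], contradicting [1 < #|G|]. *)
have [S1|S1] := leqP #|S false| 1.
  have [x xr] := subcube_neq0 r; move: (xr); rewrite -(unionS false) //.
  case/bigcupP => u uS _.
  have Su : S false = [set u].
    by apply/eqP; rewrite eq_sym eqEcard sub1set uS cards1.
  have ru : subcube r = subcube u by rewrite -(unionS false) // Su big_set1.
  have uP : u \in P := subsetP (SG false) _ uS.
  have uD : u \notin D.
    apply/negP; rewrite in_set2 => /orP[] /eqP eu; move: same;
    by rewrite Su !in_set1 eu eqxx ?[arm w i j a == _]eq_sym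
       (negbTE (corner_neq_arm _ _ _ _ _)).
  suff: G \subset [set fcons None u].
    by move/subset_leq_card; rewrite cards1 leqNgt G1.
  apply/subsetP => s sG; have [p [v es]] := fconsP s; subst s.
  have [c pc] : exists c, compat p c.
    by case: (p) => [c|]; [exists c; rewrite /compat eqxx orbT | exists true].
  have vS : v \in S c by rewrite SE; apply/existsP; exists p; rewrite pc.
  have vu : v = u.
    apply: (subcube_sub_partition (pS c)); first exact: (subsetP (SG c)).
      by case: (c); rewrite /= ?in_setU ?in_setD ?uD ?uP.
    by rewrite -ru -(unionS c) //; apply: bigcup_sup.
  rewrite vu in sG *; rewrite in_set1; have := subsetP GF _ sG; rewrite mem_glue.
  case: (p) => [[]|] // uE; last by rewrite uE in uD.
  by rewrite (disjointFr EP uE) in uP.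
(* A proper trace with at least two words would separate the corner from the arm, against [same]. So
   the trace is all of [P], the union is the whole cube, and [G] is the whole family. *)
have SP : S false = P.
  apply/eqP; rewrite eqEcard (SG false) leqNgt; apply/negP => lt.
  have := spl (S false) r (SG false); rewrite S1 lt => /(_ isT (unionS false isT)).
  by rewrite same eqxx.
suff: glue P D E \subset G by move/subset_leq_card; rewrite leqNgt GF1.
apply/subsetP => h hF; have [y yh] := subcube_neq0 h.
rewrite (partition_mem pF GF e hF yh); have [c [x ->]] := fconsP y.
rewrite mem_fcons -(unionS false) // SP; apply/bigcupP.
by have /partitionP[cov _] := pP; have [u uP xu] := cov x; exists u.
Qed.

(** * Induction on the dimension *)

Definition grows n (P : {set word n}) w i j a b :=
  [/\ i != j, elbow w i j a b \subset P & splits_elbow P w i j a b].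

Lemma glue_grows n (P : {set word n}) w i j a b :
  subcube_partition P -> tight P -> #|P| = 2 * n - 1 -> grows P w i j a b ->
  exists F : {set word n.+1},
    [/\ subcube_partition F, tight F, irreducible F, #|F| = 2 * n.+1 - 1
      & exists w' i' j' a' b', grows F w' i' j' a' b'].
Proof.
move=> pP tP cP [ij DP spl].
exists (glue P (elbow w i j a b) (elbow w j i (~~ b) (~~ a))).
have irr := glue_irreducible ij pP DP spl.
(* Positivity is needed for the truncated subtraction in [2 * n - 1 + 2 = 2 * n.+1 - 1]. *)
have n0 : 0 < n by case: n i {j w P pP tP cP DP spl irr ij} => [[]|].
split=> //.
- apply: glue_partition => //; first exact: elbow_disjoint.
  exact: elbow_flip_partition.
- by apply: glue_tight DP tP _; apply: set22.
- by rewrite card_glue // card_elbow cP; lia.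
(* The next L joins the old arm on face [false] to the new corner on face [true]: both have [~~ a]
   at [i], while at [j] the arm is free and the corner has [~~ b]. *)
pose v := [ffun k => if k == i then Some (~~ a) else w k].
exists (fcons None v), ord0, (lift ord0 j), true, (~~ b).
have ji : j != i by rewrite eq_sym.
split=> //; last exact: irreducible_splits.
have -> : elbow (fcons None v) ord0 (lift ord0 j) true (~~ b) =
    [set fcons (Some true) (corner w j i (~~ b) (~~ a));
         fcons (Some false) (arm w i j a)].
  congr [set _; _]; apply/ffunP => k; rewrite !ffunE;
    case: (unliftP ord0 k) => [l|] ->; rewrite ?eqxx //= (inj_eq lift_inj) !ffunE.
    by case: eqP => // ->.
  have [->|] := eqVneq l j; last by case: eqP.
  by rewrite (negbTE ji).
by rewrite subUset !sub1set !mem_glue /elbow set21 set22.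
Qed.

Lemma base_grows : exists P : {set word 2},
  [/\ subcube_partition P, tight P, #|P| = 3
    & exists w i j a b, grows P w i j a b].
Proof.
pose w : word 2 := [ffun=> None].
(* In the partition {00, 01, 1*}, [u] is 01 and [D] consists of 00 and 1*. *)
pose i : 'I_2 := ord0; pose j : 'I_2 := ord_max.
pose u : word 2 := upd2 w i j (Some false) (Some true).
pose D := elbow w i j false false.
have ij : i != j by [].
have memp x : x \in subcube (plane w i j).
  by apply/subcubeP => k; rewrite !ffunE !if_same.
have mu (x : point 2) : (x \in subcube u) = (x i == false) && (x j == true).
  by rewrite (mem_corner w false true x ij) memp andbT.
have mc (x : point 2) :
    (x \in subcube (corner w i j false false)) = (x i == false) && (x j == false).
  by rewrite mem_corner // memp andbT.
have ma (x : point 2) : (x \in subcube (arm w i j false)) = (x i != false).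
  by rewrite mem_arm // memp andbT.
have uD : u \notin D.
  have [x xu] := subcube_neq0 u; apply/negP; rewrite in_set2.
  case/orP=> /eqP e; move: (xu); rewrite {1}e ?mc ?ma; move: xu; rewrite mu;
  by case: (x i) (x j) => [] [].
have cP : #|u |: D| = 3 by rewrite cardsU1 uD card_elbow.
exists (u |: D); split=> //.
- apply/partitionP; split=> [x|x s t].
    case xi: (x i).
      by exists (arm w i j false); rewrite ?ma ?xi // in_setU1 in_set2 eqxx !orbT.
    case xj: (x j); first by exists u; rewrite ?mu ?xi ?xj // setU11.
    exists (corner w i j false false); rewrite ?mc ?xi ?xj //.
    by rewrite in_setU1 in_set2 eqxx orbT.
  rewrite !in_setU1 !in_set1.
  by move=> /or3P[] /eqP-> /or3P[] /eqP-> //; rewrite ?mu ?mc ?ma;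
    case: (x i) (x j) => [] [].
- move=> k; exists u; first by rewrite in_setU1 eqxx.
  have [->|ki] := eqVneq k i; first by rewrite !ffunE.
  have -> : k = j by apply/val_inj; case: k ki => -[|[|]].
  by rewrite !ffunE.
exists w, i, j, false, false; split=> //; first exact: subsetU1.
move=> G r GP; rewrite cP => /andP[G1 G3] e.
(* A subfamily inside the L is excluded, so [G] contains [u]. Having exactly two words, it contains
   just one of the corner and the arm. *)
have Gsub : G \subset D -> false.
  by move=> GD; case: (elbow_sub ij GD G1 e).
apply/negP => /eqP same; have [uG|uG] := boolP (u \in G); last first.
  suff: false by [].
  apply: Gsub; apply/subsetP => v vG; have := subsetP GP _ vG.
  by rewrite in_setU1 => /orP[/eqP vu|//]; rewrite vu (negbTE uG) in vG.
have [cG|cG] := boolP (corner w i j false false \in G).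
  suff: u |: D \subset G by move/subset_leq_card; rewrite cP leqNgt G3.
  by rewrite !subUset !sub1set uG cG -same cG.
suff: G \subset [set u] by move/subset_leq_card; rewrite cards1 leqNgt G1.
apply/subsetP => v vG; have := subsetP GP _ vG; rewrite in_setU1 in_set1 in_set2.
by case/or3P=> // /eqP ev; rewrite ev ?(negbTE cG) -?same ?(negbTE cG) in vG.
Qed.

(** Irreducibility is left out because the base of length 2 lacks it; one further gluing supplies it
    from length 3 on. *)
Lemma exists_grows n : 1 < n -> exists P : {set word n},
  [/\ subcube_partition P, tight P, #|P| = 2 * n - 1
    & exists w i j a b, grows P w i j a b].
Proof.
case: n => [|[|n]] // _; elim: n => [|n [P [pP tP cP]]]; first exact: base_grows.
case=> w [i [j [a [b gP]]]].
by have [F [pF tF _ cF gF]] := glue_grows pP tP cP gP; exists F.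
Qed.

Theorem theorem2p20 (n : nat) (hn : 3 <= n) :
  exists F : {set word n},
    [/\ subcube_partition F, tight F, irreducible F & #|F| = 2 * n - 1].
Proof.
case: n hn => // n /exists_grows[P [pP tP cP [w [i [j [a [b gP]]]]]]].
by have [F [pF tF iF cF _]] := glue_grows pP tP cP gP; exists F.
Qed.
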